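(* There is an algorithm to decide, for a given CFSM protocol $\mathbf P$ with communication graph $(N,E)$ and a given family of recognizable relations $\mathbf R(S)\subseteq\prod_{\xi\in E}M_\xi^*$ indexed by the composite states $S\in\prod_{j\in N}K_j$ (each given effectively, e.g. as a finite union of products of regular languages specified by finite automata), whether the family is consistent with respect to $\mathbf P$.
   Context: A CFSM protocol $\mathbf P$ has a finite directed communication graph $G=(N,E)$ (edge $\xi$ has tail $-\xi$, head $+\xi$), pairwise disjoint finite message sets $M_\xi$, and for each $j\in N$ a finite state machine $F_j=(K_j,\Sigma_j,T_j,h_j)$: finite state set $K_j$, initial state $h_j$, alphabet $\Sigma_j=\{+b: b\in M_\xi,\ j=+\xi\}\cup\{-b: b\in M_\xi,\ j=-\xi\}$, transitions $T_j\subseteq K_j\times\Sigma_j\times K_j$ ($+b$ = receive, $-b$ = send). A composite state is $S=(p_j:j\in N)$; a channel content is $C=(x_\xi:\xi\in E)$, $x_\xi\in M_\xi^*$; global states are pairs $(S,C)$. A step: some machine $F_i$ takes $p_i\xrightarrow{-b}q_i$ with $b\in M_\beta$, $i=-\beta$, appending $b$ to the end of $x_\beta$; or takes $p_i\xrightarrow{+b}q_i$ with $b\in M_\beta$, $i=+\beta$, provided $x_\beta$ begins with $b$, removing it; all else unchanged. $\vdash^*$ means reachability by finitely many steps. A relation $\mathbf R\subseteq\prod_{\xi\in E}M_\xi^*$ is recognizable if it is a finite union of sets $\prod_{\xi\in E}L_\xi$ with each $L_\xi\subseteq M_\xi^*$ regular. A family $\mathbf R(S)$ is consistent (with respect to $\mathbf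 P$) if $(S,C)\vdash^*(S',C')$ and $C\in\mathbf R(S)$ imply $C'\in\mathbf R(S')$. *)

(* Defs.v *)
From mathcomp Require Import all_boot.
Set Implicit Arguments. Unset Strict Implicit. Unset Printing Implicit Defensive.

(* "There is an algorithm" := there is a register machine program,            *)
(* since with classical axioms any bare Coq function would do.      *)

Inductive instr :=
  | Inc of nat & nat          (* Inc r j   : R r := R r + 1; goto j              *)
  | Dec of nat & nat & nat.   (* Dec r j k : if R r = 0 goto k
                                             else R r := R r - 1; goto j         *)

Definition program := seq instr.
Definition config := (nat * (nat -> nat))%type.

Definition rm_step (p : program) (c : config) : config :=
  let: (pc, R) := c in
  if pc < size p then
    match nth (Inc 0 0) p pc with
    | Inc r j => (j, fun x => if x == r then (R r).+1 else R x)
    | Dec r j k =>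
        if R r == 0 then (k, R)
        else (j, fun x => if x == r then (R r).-1 else R x)
    end
  else c.

Definition rm_run (p : program) (n : nat) (c : config) : config :=
  iter n (rm_step p) c.

Definition rm_halted (p : program) (c : config) : bool := size p <= c.1.

Definition rm_init (m : nat) : config := (0, fun x => if x == 0 then m else 0).

Definition rm_output (c : config) : nat := c.2 0.

(* Machines are numbered 0 .. |N|-1, edges 0 .. |E|-1.  The message set M_xi *)
(* of edge xi is {(xi,k) | k < m_xi}; hence the M_xi are pairwise disjoint;  *)
(* a message of M_xi is represented by its index k.                           *)

(* action (s, xi, k): s = true : send  -(xi,k);  s = false: receive +(xi,k) *)
Definition action := (bool * nat * nat)%type.
Definition transition := (nat * action * nat)%type.
(* machine F_j = (number of states |K_j|, initial state h_j, transitions T_j) *)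
Definition machine := (nat * nat * seq transition)%type.
(* protocol = (edges as (tail, head) pairs, message counts m_xi, machines) *)
Definition protocol := (seq (nat * nat) * seq nat * seq machine)%type.

Definition edges (P : protocol) : seq (nat * nat) := P.1.1.
Definition msgcount (P : protocol) (xi : nat) : nat := nth 0 P.1.2 xi.
Definition machines (P : protocol) : seq machine := P.2.
Definition nnodes (P : protocol) : nat := size (machines P).
Definition nedges (P : protocol) : nat := size (edges P).
Definition tail (P : protocol) (xi : nat) : nat := (nth (0, 0) (edges P) xi).1.
Definition head (P : protocol) (xi : nat) : nat := (nth (0, 0) (edges P) xi).2.
Definition mach (P : protocol) (j : nat) : machine := nth (0, 0, [::]) (machines P) j.
Definition nstates (F : machine) : nat := F.1.1.
Definition initst (F : machine) : nat := F.1.2.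
Definition trans (F : machine) : seq transition := F.2.

Definition wf_transition (P : protocol) (j : nat) (t : transition) : bool :=
  let: (p, (s, xi, k), q) := t in
  [&& p < nstates (mach P j), q < nstates (mach P j), xi < nedges P,
      k < msgcount P xi &
      (if s then tail P xi == j else head P xi == j)].

Definition wf_protocol (P : protocol) : Prop :=
  [/\ size P.1.2 = nedges P,
      (forall xi, xi < nedges P -> tail P xi < nnodes P /\ head P xi < nnodes P) &
      (forall j, j < nnodes P ->
         initst (mach P j) < nstates (mach P j) /\
         all (wf_transition P j) (trans (mach P j)))].

Definition cstate := seq nat.
Definition chans := seq (seq nat).

Definition valid_cstate (P : protocol) (S : cstate) : Prop :=
  size S = nnodes P /\ forall j, j < nnodes P -> nth 0 S j < nstates (mach P j).

Definition valid_chans (P : protocol) (C : chans) : Prop :=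
  size C = nedges P /\
  forall xi, xi < nedges P -> all (fun k => k < msgcount P xi) (nth [::] C xi).

Definition step (P : protocol) (g g' : cstate * chans) : Prop :=
  let: (S0, C) := g in let: (S', C') := g' in
  exists j, j < nnodes P /\
  exists p s xi k q, (p, (s, xi, k), q) \in trans (mach P j) /\
    nth 0 S0 j = p /\ S' = set_nth 0 S0 j q /\ xi < nedges P /\
    if s then
      tail P xi = j /\ C' = set_nth [::] C xi (rcons (nth [::] C xi) k)
    else
      head P xi = j /\
      exists rest, nth [::] C xi = k :: rest /\ C' = set_nth [::] C xi rest.

Inductive reach (P : protocol) : cstate * chans -> cstate * chans -> Prop :=
  | reach_refl g : reach P g g
  | reach_step g g' g'' : step P g g' -> reach P g' g'' -> reach P g g''.

(* Nondeterministic finite automata over the alphabet {0..m_xi-1} (= M_xi):   *)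
(* (number of states, initial states, final states, transitions (p, a, q)).   *)
Definition nfa := (nat * seq nat * seq nat * seq (nat * nat * nat))%type.
Definition nfa_nstates (A : nfa) : nat := A.1.1.1.
Definition nfa_init (A : nfa) : seq nat := A.1.1.2.
Definition nfa_final (A : nfa) : seq nat := A.1.2.
Definition nfa_trans (A : nfa) : seq (nat * nat * nat) := A.2.

Definition nfa_next (A : nfa) (cur : seq nat) (a : nat) : seq nat :=
  [seq t.2 | t <- nfa_trans A & (t.1.1 \in cur) && (t.1.2 == a)].

Definition nfa_accepts (A : nfa) (w : seq nat) : bool :=
  has (fun q => q \in nfa_final A) (foldl (nfa_next A) (nfa_init A) w).

Definition wf_nfa (P : protocol) (xi : nat) (A : nfa) : bool :=
  [&& all (fun q => q < nfa_nstates A) (nfa_init A),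
      all (fun q => q < nfa_nstates A) (nfa_final A) &
      all (fun t => [&& t.1.1 < nfa_nstates A, t.2 < nfa_nstates A
                      & t.1.2 < msgcount P xi]) (nfa_trans A)].

(* A product prod_xi L_xi is a list of automata, one per edge; a recognizable *)
(* relation is a finite union of such products.                              *)
Definition recdesc := seq (seq nfa).

Definition in_product (prd : seq nfa) (C : chans) : Prop :=
  forall xi, xi < size prd -> nfa_accepts (nth (0, [::], [::], [::]) prd xi) (nth [::] C xi).

Definition in_rec (D : recdesc) (C : chans) : Prop :=
  exists2 prd, prd \in D & in_product prd C.

(* A family R(S) is given as a table: composite state S |-> description. *)
Definition family := seq (cstate * recdesc).

Definition fam_lookup (F : family) (S : cstate) : recdesc :=
  nth [::] (map snd F) (index S (map fst F)).

Definition wf_family (P : protocol) (F : family) : Prop :=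
  [/\ uniq (map fst F),
      (forall S, valid_cstate P S -> S \in map fst F),
      (forall S, S \in map fst F -> valid_cstate P S) &
      (forall e, e \in F -> forall prd, prd \in e.2 ->
          size prd = nedges P /\
          forall xi, xi < nedges P -> wf_nfa P xi (nth (0, [::], [::], [::]) prd xi))].

Definition inR (F : family) (S : cstate) (C : chans) : Prop :=
  in_rec (fam_lookup F S) C.

Definition consistent (P : protocol) (F : family) : Prop :=
  forall S C S' C', valid_cstate P S -> valid_chans P C ->
    reach P (S, C) (S', C') -> inR F S C -> inR F S' C'.

(* Problem instances, encoded as natural numbers via the countType pickle. *)
Definition instance := (protocol * family)%type.
Definition wf_instance (x : instance) : Prop := wf_protocol x.1 /\ wf_family x.1 x.2.

(* Main.v *)
Require Import Defs.
From mathcomp Require Import all_boot zify.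
From Stdlib Require Import FunctionalExtensionality.
Set Implicit Arguments. Unset Strict Implicit. Unset Printing Implicit Defensive.

(** Consistency is equivalent to closure under a single step, so a failure of
    consistency is witnessed by one channel content.  A word acts on the states
    of the finitely many given automata by transition relations; by the
    pigeonhole principle every word can be shortened, keeping its first letter,
    to one of length at most the number of possible families of relations
    without changing the action of the word or of its tail.  Hence a
    counterexample can be sought among finitely many channel contents.
    To run this search on a register machine, note that [pickle] codes lists
    and pairs through [(n, m) |-> 2 ^ n * (2 * m + 1)]: the functions computed
    by while programs are closed under this pairing, its projections and
    iteration, hence under all the list operations used by the search. *)

(** * While programs and their compilation to register machines *)

Definition regs := nat -> nat.

Definition upd (R : regs) r v : regs := fun x => if x == r then v else R x.

Inductive cmd :=
  | CSkip
  | CInc of nat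
  | CDec of nat
  | CSeq of cmd & cmd
  | CWhile of nat & cmd.

(** A relation rather than a function, since loops may diverge: derivations are the terminating
    runs. *)
Inductive exec : cmd -> regs -> regs -> Prop :=
  | exec_skip R : exec CSkip R R
  | exec_inc r R : exec (CInc r) R (upd R r (R r).+1)
  | exec_dec r R : exec (CDec r) R (upd R r (R r).-1)
  | exec_seq c1 c2 R1 R2 R3 :
      exec c1 R1 R2 -> exec c2 R2 R3 -> exec (CSeq c1 c2) R1 R3
  | exec_while0 r c R : R r = 0 -> exec (CWhile r c) R R
  | exec_whileS r c R1 R2 R3 :
      R1 r <> 0 -> exec c R1 R2 -> exec (CWhile r c) R2 R3 ->
      exec (CWhile r c) R1 R3.

Fixpoint csize c :=
  match c with
  | CSkip => 0
  | CInc _ | CDec _ => 1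
  | CSeq c1 c2 => csize c1 + csize c2
  | CWhile _ c => (csize c).+4
  end.

(* The code is position dependent: [pc] is the address of its first
   instruction.  The last two instructions of a loop form an unconditional
   jump that leaves the registers unchanged. *)
Fixpoint compile c pc : program :=
  match c with
  | CSkip => [::]
  | CInc r => [:: Inc r pc.+1]
  | CDec r => [:: Dec r pc.+1 pc.+1]
  | CSeq c1 c2 => compile c1 pc ++ compile c2 (pc + csize c1)
  | CWhile r c =>
      let e := pc.+2 + csize c in
      [:: Dec r pc.+1 e.+2; Inc r pc.+2] ++ compile c pc.+2
        ++ [:: Inc r e.+1; Dec r pc pc]
  end.

Local Arguments rm_step : simpl never.

Lemma size_compile c pc : size (compile c pc) = csize c.
Proof.
elim: c pc => //= [c1 IH1 c2 IH2|r c IH] pc; first by rewrite size_cat IH1 IH2.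
by rewrite size_cat IH /= addn2.
Qed.

Lemma compile_while r c pc (e := pc.+2 + csize c) :
  compile (CWhile r c) pc =
  [:: Dec r pc.+1 e.+2; Inc r pc.+2] ++ compile c pc.+2
     ++ [:: Inc r e.+1; Dec r pc pc].
Proof. by []. Qed.

Lemma upd_same R r : upd R r (R r) = R.
Proof. by apply: functional_extensionality => x; rewrite /upd; case: eqP => // ->. Qed.

Lemma upd_upd R r v w : upd (upd R r v) r w = upd R r w.
Proof. by apply: functional_extensionality => x; rewrite /upd; case: eqP. Qed.

Lemma upd_eq R r v : upd R r v r = v.
Proof. by rewrite /upd eqxx. Qed.

Lemma rm_run_add p m n c : rm_run p (m + n) c = rm_run p m (rm_run p n c).
Proof. exact: iterD. Qed.

Definition instr_effect i R : config :=
  match i with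
  | Inc r j => (j, upd R r (R r).+1)
  | Dec r j k => if R r == 0 then (k, R) else (j, upd R r (R r).-1)
  end.

(** The splitting of [p] is an equation so that one program can be split at several addresses, as
    the loop case below requires. *)
Lemma rm_step_at p p1 i p2 pc R : p = p1 ++ i :: p2 -> pc = size p1 ->
  rm_step p (pc, R) = instr_effect i R.
Proof.
move=> -> ->; rewrite /rm_step size_cat /= addnS ltnS leq_addr.
by rewrite nth_cat ltnn subnn; case: i.
Qed.

Lemma rm_step_cat p1 i p2 R :
  rm_step (p1 ++ i :: p2) (size p1, R) = instr_effect i R.
Proof. exact: rm_step_at. Qed.

(** Induction on the execution, not on the command: after one round of a loop the same loop is still
    to be run. Arbitrary [p1] and [p2] let each subcommand run in place inside the whole program. *)
Lemma compile_correct c R R' : exec c R R' -> forall p1 p2,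
  exists n, rm_run (p1 ++ compile c (size p1) ++ p2) n (size p1, R) =
            (size p1 + csize c, R').
Proof.
elim=> {c R R'} [R|r R|r R|c1 c2 R1 R2 R3 _ IH1 _ IH2|r c R R0|r c R1 R2 R3 R0 _ IH1 _ IH2] p1 p2.
- by exists 0; rewrite addn0.
- by exists 1; rewrite /rm_run /= rm_step_cat addn1.
(* Both jump targets of the compiled [Dec] agree, and an empty register is left alone, in accordance
   with [0.-1 = 0]. *)
- exists 1; rewrite /rm_run /= rm_step_cat addn1 /=; case: eqP => [R0|//].
  by rewrite R0 -[X in upd R r X]R0 upd_same.
- have [n1] := IH1 p1 (compile c2 (size p1 + csize c1) ++ p2).
  have [n2] := IH2 (p1 ++ compile c1 (size p1)) p2.
  rewrite !size_cat !size_compile -!catA => E2 E1.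
  by exists (n2 + n1); rewrite rm_run_add E1 E2 addnA.
- by exists 1; rewrite /rm_run /= rm_step_cat /= R0; congr pair; lia.
- have [n2 E2] := IH2 p1 p2.
  have := IH1 (p1 ++ [:: Dec r (size p1).+1 ((size p1).+2 + csize c).+2;
     Inc r (size p1).+2]) ([:: Inc r ((size p1).+2 + csize c).+1; Dec r (size p1) (size p1)] ++ p2).
  rewrite size_cat addn2 => -[n1 E1].
  set p := p1 ++ _ ++ _ in E2 *.
  have ep : p = p1 ++ compile (CWhile r c) (size p1) ++ p2 by [].
  move: ep; rewrite compile_while -!catA => ep.
  (* [S1] to [S4] are the four instructions around the body. The entry test decrements [r] and the
     next instruction restores it; the closing pair increments and decrements [r] in order to jump
     back. *)
  have S1 R : R r <> 0 -> rm_step p (size p1, R) = ((size p1).+1, upd R r (R r).-1).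
    by move/eqP/negPf=> R0'; rewrite (rm_step_at _ ep) //= R0'.
  have S2 R : rm_step p ((size p1).+1, R) = ((size p1).+2, upd R r (R r).+1).
    by rewrite ep -cat_rcons (rm_step_at _ erefl) //= size_rcons.
  pose e := (size p1).+2 + csize c.
  pose p3 := p1 ++ [:: Dec r (size p1).+1 e.+2; Inc r (size p1).+2]
                ++ compile c (size p1).+2.
  have sp3 : size p3 = e by rewrite !size_cat size_compile /= /e; lia.
  have ep3 : p = p3 ++ [:: Inc r e.+1; Dec r (size p1) (size p1)] ++ p2.
    by rewrite ep /p3 -!catA.
  have S3 R : rm_step p (e, R) = (e.+1, upd R r (R r).+1).
    by rewrite (rm_step_at _ ep3).
  have S4 R : R r <> 0 -> rm_step p (e.+1, R) = (size p1, upd R r (R r).-1).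
    move/eqP/negPf=> R0'; rewrite ep3 -cat_rcons (rm_step_at _ erefl) /= ?R0' //.
    by rewrite size_rcons sp3.
  (* From right to left: entry test, body, jump back, remaining rounds. *)
  exists (n2 + (2 + (n1 + 2))); rewrite !rm_run_add.
  have -> : rm_run p 2 (size p1, R1) = ((size p1).+2, R1).
    rewrite /rm_run /= S1 // S2 upd_upd upd_eq prednK ?upd_same //.
    by case: (R1 r) R0.
  have -> : rm_run p n1 ((size p1).+2, R1) = (e, R2).
    by rewrite -E1 ep -!catA.
  have -> : rm_run p 2 (e, R2) = (size p1, R2).
    by rewrite /rm_run /= S3 S4 upd_eq ?upd_upd ?upd_same.
  by rewrite E2.
Qed.

Lemma exec_eq c R R1 R2 : exec c R R1 -> R1 =1 R2 -> exec c R R2.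
Proof. by move=> e /functional_extensionality <-. Qed.

(** * Functions computed by while programs *)

Definition zero_above d (R : regs) := forall i, d < i -> R i = 0.

(* Registers are used as a stack: register [d] holds the argument and then the
   value, the registers above [d] are scratch, those below [d] are preserved. *)
Definition while_computable (f : nat -> nat) := exists c : nat -> cmd,
  forall d R, zero_above d R -> exec (c d) R (upd R d (f (R d))).

(** All registers above 0 are initially empty, so the command for stack depth 0 applies; its code
    ends just past the last instruction, which is the halting condition. *)
Lemma while_computable_rm f : while_computable f ->
  exists prog : program, forall m, exists n,
    let c := rm_run prog n (rm_init m) in rm_halted prog c /\ rm_output c = f m.
Proof.
move=> [c cP]; exists (compile (c 0) 0) => m.
have z : zero_above 0 (rm_init m).2 by case.
have [n] := compile_correct (cP 0 _ z) [::] [::].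
rewrite cats0 /= -/(rm_init m) => E; exists n.
by rewrite /rm_init E /rm_halted /rm_output /= size_compile add0n leqnn.
Qed.

Definition incs (L : seq nat) := foldr (fun r c => CSeq (CInc r) c) CSkip L.

(** With the empty list this clears [r]; a target listed twice receives twice the value. *)
Definition transfer r L := CWhile r (CSeq (CDec r) (incs L)).

Lemma exec_incs L R : exec (incs L) R (fun x => R x + count_mem x L).
Proof.
elim: L R => /= [|r L IH] R.
  by apply: exec_eq (exec_skip _) _ => x /=; rewrite addn0.
apply: exec_eq (exec_seq (exec_inc _ _) (IH _)) _ => x /=.
by rewrite /upd [r == x]eq_sym; case: eqP => [->|_] //=; rewrite addSnnS.
Qed.

Lemma exec_transfer r L R : r \notin L ->
  exec (transfer r L) R (fun x => if x == r then 0 else R x + R r * count_mem x L).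
Proof.
move=> rL; move E: (R r) => n; elim: n R E => [|n IH] R E.
  apply: exec_eq (exec_while0 _ E) _ => x /=.
  by case: eqP => [->//|_]; rewrite mul0n addn0.
have c0 : count_mem r L = 0 by apply/count_memPn.
apply: exec_eq (exec_whileS _ (exec_seq (exec_dec _ _) (exec_incs _ _)) (IH _ _)) _.
- by rewrite E.
- by rewrite upd_eq E c0 addn0.
- move=> x /=; rewrite /upd; case: eqP => //= _.
  by rewrite mulSn addnA.
Qed.

Lemma eqn_shift d : (((d == d.+1) = false) * ((d == d.+2) = false) * ((d == d.+3) = false)
  * ((d == d.+4) = false) * ((d == d.+4.+1) = false)
  * ((d.+1 == d) = false) * ((d.+2 == d) = false) * ((d.+3 == d) = false)
  * ((d.+4 == d) = false) * ((d.+4.+1 == d) = false))%type.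
Proof. by repeat split; lia. Qed.

Ltac regs_simpl := rewrite /upd /= ?(eqxx, eqSS, eqn_shift) /=.
(* Decides pointwise equalities between explicit register updates. *)
Ltac regs_tac := let x := fresh "x" in
  intro x; regs_simpl;
  repeat match goal with
    | |- context [@eq_op _ ?a ?b] => case: (@eqP _ a b) => ?;
        try (exfalso; lia); try subst x; rewrite ?(eqxx, eqSS, eqn_shift) /=
    end; try lia; try congruence.

(** Reading a register empties it, so [t] keeps a second copy from which [r] is restored. *)
Definition copy r s t := CSeq (transfer r [:: s; t]) (transfer t [:: r]).

Lemma exec_copy r s t R : r != s -> r != t -> s != t -> R s = 0 -> R t = 0 ->
  exec (copy r s t) R (upd R s (R r)).
Proof.
move=> rs rt st Rs Rt; apply: exec_eq (exec_seq (exec_transfer _ _) (exec_transfer _ _)) _.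
- by rewrite !inE negb_or rs.
- by rewrite inE eq_sym.
- by regs_tac.
Qed.

Lemma exec_clear r R : exec (transfer r [::]) R (upd R r 0).
Proof.
by apply: exec_eq (exec_transfer _ _) _ => // x; rewrite /upd muln0 addn0.
Qed.

(** * Basic functions, composition and iteration *)

Lemma while_computable_id : while_computable id.
Proof. by exists (fun _ => CSkip) => d R _; rewrite upd_same; apply: exec_skip. Qed.

Lemma while_computable_succ : while_computable succn.
Proof. by exists CInc => d R _; apply: exec_inc. Qed.

Lemma while_computable_pred : while_computable predn.
Proof. by exists CDec => d R _; apply: exec_dec. Qed.

Lemma while_computable_zero : while_computable (fun=> 0).
Proof. by exists (transfer^~ [::]) => d R _; apply: exec_clear. Qed.

Lemma while_computable_comp f g :
  while_computable f -> while_computable g -> while_computable (fun n => f (g n)).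
Proof.
move=> [cf Hf] [cg Hg]; exists (fun d => CSeq (cg d) (cf d)) => d R z.
apply: exec_seq (Hg _ _ z) _; apply: exec_eq (Hf _ _ _) _.
- by move=> i di; rewrite /upd; case: eqP => [?|_]; [lia|apply: z].
- by rewrite upd_upd upd_eq.
Qed.

(** Register [d] keeps the argument, [d.+1] is the loop counter and [d.+2] the accumulator. Each
    subprogram runs at a depth above everything still needed; in particular [g] runs at [d.+2] and
    so preserves the counter. *)
Lemma while_computable_iter f g h :
  while_computable f -> while_computable g -> while_computable h ->
  while_computable (fun n => iter (f n) g (h n)).
Proof.
move=> [cf Hf] [cg Hg] [ch Hh].
exists (fun d => CSeq (copy d d.+1 d.+2) (CSeq (cf d.+1)
  (CSeq (copy d d.+2 d.+3) (CSeq (ch d.+2)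
  (CSeq (CWhile d.+1 (CSeq (CDec d.+1) (cg d.+2)))
  (CSeq (transfer d [::]) (transfer d.+2 [:: d]))))))) => d R z.
have z1 : R d.+1 = 0 by apply: z.
have z2 : R d.+2 = 0 by apply: z; lia.
have z3 : R d.+3 = 0 by apply: z; lia.
have loop R0 : zero_above d.+2 R0 -> exec (CWhile d.+1 (CSeq (CDec d.+1) (cg d.+2))) R0
   (upd (upd R0 d.+1 0) d.+2 (iter (R0 d.+1) g (R0 d.+2))).
  move En: (R0 d.+1) => n; elim: n R0 En => [|n IH] R0 En z0.
    by apply: exec_eq (exec_while0 _ En) _; regs_tac.
  apply: exec_whileS; first by rewrite En.
    apply: exec_seq (exec_dec _ _) (Hg _ _ _).
    by move=> i di; rewrite /upd; case: eqP => [?|_]; [lia|apply: z0].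
  apply: exec_eq (IH _ _ _) _.
  - by rewrite /upd En; repeat case: eqP; lia.
  - by move=> i di; rewrite /upd; repeat case: eqP; try lia; move=> *; apply: z0.
  - have -> : upd R0 d.+1 (R0 d.+1).-1 d.+2 = R0 d.+2 by rewrite /upd; case: eqP; lia.
    by rewrite upd_eq -iterSr; regs_tac.
have zi i : d < i -> R i = 0 by apply: z.
apply: exec_seq (exec_copy _ _ _ z1 z2) _; try lia.
apply: exec_seq (Hf _ _ _) _.
  by move=> i di; rewrite /upd; case: eqP; [lia|move=> _; apply: zi; lia].
apply: exec_seq (exec_copy _ _ _ _ _) _; try (rewrite /upd; repeat case: eqP; lia).
apply: exec_seq (Hh _ _ _) _.
  by move=> i di; rewrite /upd; repeat case: eqP; try lia; move=> *; apply: zi; lia.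
apply: exec_seq (loop _ _) _.
  by move=> i di; rewrite /upd; repeat case: eqP; try lia; move=> *; apply: zi; lia.
apply: exec_seq (exec_clear _ _) _.
apply: exec_eq (exec_transfer _ _) _; first by rewrite inE; lia.
move=> x; rewrite /upd !eqxx /=.
have e1 : (d == d.+1) = false by lia.
have e2 : (d == d.+2) = false by lia.
have e3 : (d.+1 == d) = false by lia.
have e4 : (d.+1 == d.+2) = false by lia.
have e5 : (d.+2 == d) = false by lia.
have e6 : (d.+2 == d.+1) = false by lia.
rewrite ?(eqxx, e1, e2, e3, e4, e5, e6) /=.
case: (x =P d) => [->|xd]; first by rewrite ?(eqxx, e1, e2, e3, e4, e5, e6); lia.
have -> : (d == x) = false by lia.
case: (x =P d.+2) => [->|x2]; first by rewrite z2.
case: (x =P d.+1) => [->|x1]; first by rewrite z1; lia.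
by rewrite muln0 addn0.
Qed.

(** * Pairing and its projections *)

Definition cpair n m := 2 ^ n * m.*2.+1.

(** The odd factor is built in register [d] by emptying [d.+1] into it twice and adding 1. It is
    then doubled as often as [d.+2], holding the value of [f], prescribes, with [d.+1] as
    scratch. *)
Lemma while_computable_cpair f g : while_computable f -> while_computable g ->
  while_computable (fun n => cpair (f n) (g n)).
Proof.
move=> [cf Hf] [cg Hg].
pose double d := CSeq (transfer d [:: d.+1; d.+1]) (transfer d.+1 [:: d]).
have dbl d R : R d.+1 = 0 -> exec (double d) R (upd R d (R d).*2).
  move=> z; apply: exec_eq (exec_seq (exec_transfer _ _) (exec_transfer _ _)) _;
    try by rewrite !inE; lia.
  by regs_tac.
exists (fun d => CSeq (copy d d.+1 d.+2) (CSeq (cg d.+1)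
  (CSeq (copy d d.+2 d.+3) (CSeq (cf d.+2)
  (CSeq (transfer d [::]) (CSeq (transfer d.+1 [:: d; d]) (CSeq (CInc d)
   (CWhile d.+2 (CSeq (CDec d.+2) (double d)))))))))) => d R z.
have z1 : R d.+1 = 0 by apply: z.
have z2 : R d.+2 = 0 by apply: z; lia.
have z3 : R d.+3 = 0 by apply: z; lia.
have loop R0 : R0 d.+1 = 0 -> exec (CWhile d.+2 (CSeq (CDec d.+2) (double d))) R0
   (upd (upd R0 d.+2 0) d (2 ^ R0 d.+2 * R0 d)).
  move En: (R0 d.+2) => n; elim: n R0 En => [|n IH] R0 En z0.
    by apply: exec_eq (exec_while0 _ En) _; regs_tac.
  apply: exec_whileS; first by rewrite En.
    apply: exec_seq (exec_dec _ _) (dbl _ _ _).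
    by rewrite /upd; case: eqP; lia.
  apply: exec_eq (IH _ _ _) _.
  - by rewrite /upd En; repeat case: eqP; lia.
  - by rewrite /upd; repeat case: eqP; lia.
  - have -> : upd R0 d.+2 (R0 d.+2).-1 d = R0 d by rewrite /upd; case: eqP; lia.
    rewrite upd_eq -mul2n mulnA [_ * 2]mulnC -expnS.
    by regs_tac.
apply: exec_seq (exec_copy _ _ _ z1 z2) _; try lia.
apply: exec_seq (Hg _ _ _) _.
  by move=> i di; rewrite /upd; case: eqP; [lia|move=> _; apply: z; lia].
apply: exec_seq (exec_copy _ _ _ _ _) _; try (rewrite /upd; repeat case: eqP; lia).
apply: exec_seq (Hf _ _ _) _.
  by move=> i di; rewrite /upd; repeat case: eqP; try lia; move=> *; apply: z; lia.
apply: exec_seq (exec_clear _ _) _.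
apply: exec_seq (exec_transfer _ _) _; first by rewrite !inE; lia.
apply: exec_seq (exec_inc _ _) _.
apply: exec_eq (loop _ _) _; first by rewrite /upd; repeat case: eqP; lia.
have e1 : (d == d.+1) = false by lia.
have e2 : (d == d.+2) = false by lia.
have e3 : (d.+1 == d) = false by lia.
have e4 : (d.+1 == d.+2) = false by lia.
have e5 : (d.+2 == d) = false by lia.
have e6 : (d.+2 == d.+1) = false by lia.
move=> x; rewrite /upd /= ?(eqxx, e1, e2, e3, e4, e5, e6) /=.
rewrite !muln0 !addn0 add0n addn1 muln2 /cpair.
case: (x =P d) => [//|xd].
case: (x =P d.+2) => [->|x2]; first by rewrite z2.
case: (x =P d.+1) => [->|x1]; first by rewrite z1; lia.
have -> : (d == x) = false by lia.
by rewrite muln0 addn0.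
Qed.

(** The invariant is the full register content [F i] after [i] rounds, and [r] counts the rounds
    left. *)
Lemma exec_while_iter r c (F : nat -> regs) n :
  (forall i, i <= n -> F i r = n - i) ->
  (forall i, i < n -> exec c (F i) (F i.+1)) ->
  exec (CWhile r c) (F 0) (F n).
Proof.
elim: n F => [|n IH] F Fr Fc; first by apply: exec_while0; rewrite Fr.
apply: exec_whileS (Fc 0 _) _ => //; first by rewrite Fr.
by apply: (IH (F \o succn)) => i iln /=; [rewrite Fr|apply: Fc].
Qed.

Ltac solve_regs := regs_simpl; repeat case: eqP; lia.

(* Halving: after [n] rounds registers [d.+3] and [d.+4] hold the upper and
   lower half of [n]; their difference is the parity of [n]. *)
Definition halve d := CSeq
  (CWhile d (CSeq (CDec d) (CSeq (transfer d.+3 [:: d.+4.+1])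
    (CSeq (transfer d.+4 [:: d.+3]) (CSeq (CInc d.+3) (transfer d.+4.+1 [:: d.+4]))))))
  (CWhile d.+4 (CSeq (CDec d.+4) (CSeq (CDec d.+3) (CInc d)))).

Lemma exec_halve d R : R d.+3 = 0 -> R d.+4 = 0 -> R d.+4.+1 = 0 ->
  exec (halve d) R (upd (upd R d.+3 (odd (R d))) d (R d)./2).
Proof.
move=> z3 z4 z5; set v := R d.
(* In the first loop the halves exchange roles: the new lower half of [i.+1] is the old upper half,
   and the new upper half is the old lower half plus 1. The second loop, described by [G], moves the
   lower half to [d] while subtracting it from the upper one. *)
pose F i := upd (upd (upd R d (v - i)) d.+3 (uphalf i)) d.+4 i./2.
pose G i := upd (upd (upd R d i) d.+3 (uphalf v - i)) d.+4 (v./2 - i).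
have EF : exec (CWhile d (CSeq (CDec d) (CSeq (transfer d.+3 [:: d.+4.+1])
    (CSeq (transfer d.+4 [:: d.+3]) (CSeq (CInc d.+3) (transfer d.+4.+1 [:: d.+4])))))) (F 0) (F v).
  apply: exec_while_iter => i iv; first by rewrite /F; solve_regs.
  apply: exec_eq (exec_seq (exec_dec _ _) (exec_seq (exec_transfer _ _)
    (exec_seq (exec_transfer _ _) (exec_seq (exec_inc _ _) (exec_transfer _ _))))) _;
    try by rewrite inE; lia.
  by rewrite /F; regs_tac; rewrite uphalfE; lia.
have EG : exec (CWhile d.+4 (CSeq (CDec d.+4) (CSeq (CDec d.+3) (CInc d)))) (G 0) (G v./2).
  apply: exec_while_iter => i iv; first by rewrite /G; solve_regs.
  apply: exec_eq (exec_seq (exec_dec _ _) (exec_seq (exec_dec _ _) (exec_inc _ _))) _.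
  by rewrite /G; regs_tac.
have F0 : F 0 = R.
  by apply: functional_extensionality; rewrite /F /v; regs_tac.
have FG : F v = G 0.
  by apply: functional_extensionality; rewrite /F /G; regs_tac.
rewrite F0 in EF; rewrite FG in EF.
apply: exec_eq (exec_seq EF EG) _.
have e : uphalf v = odd v + v./2 by exact: uphalf_half.
by rewrite /G e; regs_tac.
Qed.

(** Halving is repeated until the halved number was odd; that last halving turns [m.*2.+1] into [m].
    Register [d.+1] counts the halvings of even numbers, and [d.+2] is the flag that keeps the loop
    going, copied at first from the argument so that 0 is left untouched. The innermost loop, run on
    the parity bit in [d.+3], undoes both increments in the odd case. *)
Definition uncpair d := CSeq (copy d d.+2 d.+3)
  (CWhile d.+2 (CSeq (transfer d.+2 [::]) (CSeq (halve d)
    (CSeq (CInc d.+1) (CSeq (CInc d.+2)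
      (CWhile d.+3 (CSeq (CDec d.+3) (CSeq (CDec d.+1) (CDec d.+2))))))))).

Lemma exec_uncpair0 d R : zero_above d R -> R d = 0 -> exec (uncpair d) R R.
Proof.
move=> z R0; apply: exec_seq.
  by apply: exec_copy; rewrite ?z //; lia.
by rewrite R0 -[X in upd R _ X](z d.+2) ?upd_same; [apply: exec_while0; rewrite z|]; lia.
Qed.

Lemma exec_uncpair d R n m : zero_above d R -> R d = cpair n m ->
  exec (uncpair d) R (upd (upd R d m) d.+1 n).
Proof.
move=> z Rd; apply: exec_seq.
  by apply: exec_copy; rewrite ?z //; lia.
set body := CSeq (transfer _ _) _.
(* A loop on a register holding 0 or 1 is a conditional. *)
have cond (R1 : regs) (b : bool) : R1 d.+3 = b ->
    exec (CWhile d.+3 (CSeq (CDec d.+3) (CSeq (CDec d.+1) (CDec d.+2)))) R1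
      (if b then upd (upd (upd R1 d.+3 0) d.+1 (R1 d.+1).-1) d.+2 (R1 d.+2).-1 else R1).
  case: b => /= R13; last by apply: exec_while0.
  apply: exec_whileS; first by rewrite R13; lia.
    exact: exec_seq (exec_dec _ _) (exec_seq (exec_dec _ _) (exec_dec _ _)).
  by apply: exec_eq (exec_while0 _ _) _; [solve_regs|regs_tac].
have bodyP R0 : R0 d.+3 = 0 -> R0 d.+4 = 0 -> R0 d.+4.+1 = 0 ->
  exec body R0 (upd (upd (upd R0 d (R0 d)./2) d.+1 (R0 d.+1 + ~~ odd (R0 d)))
                 d.+2 (~~ odd (R0 d))).
  move=> z3 z4 z5; apply: exec_seq (exec_clear _ _) _.
  apply: exec_seq (exec_halve _ _ _) _; try solve_regs.
  have -> : upd R0 d.+2 0 d = R0 d by solve_regs.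
  apply: exec_seq (exec_inc _ _) _; apply: exec_seq (exec_inc _ _) _.
  apply: exec_eq (cond _ (odd (R0 d)) _) _; first by solve_regs.
  by case: (odd (R0 d)); regs_tac.
have loop k R0 : R0 d = cpair k m -> R0 d.+2 <> 0 -> R0 d.+3 = 0 -> R0 d.+4 = 0 ->
    R0 d.+4.+1 = 0 ->
    exec (CWhile d.+2 body) R0 (upd (upd (upd R0 d m) d.+1 (R0 d.+1 + k)) d.+2 0).
  elim: k R0 => [|k IH] R0 E0 E2 z3 z4 z5; apply: exec_whileS E2 (bodyP _ z3 z4 z5) _.
    have o : odd (R0 d) by rewrite E0 /cpair mul1n /= odd_double.
    have h : (R0 d)./2 = m by rewrite E0 /cpair mul1n /= uphalf_double.
    by rewrite o h; apply: exec_eq (exec_while0 _ _) _; rewrite ?upd_eq.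
  have e : R0 d = (cpair k m).*2 by rewrite E0 /cpair expnS -mulnA mul2n.
  rewrite e odd_double doubleK.
  by apply: exec_eq (IH _ _ _ _ _ _) _; try solve_regs; regs_tac.
apply: exec_eq (loop n _ _ _ _ _ _) _.
- by solve_regs.
- have : R d > 0 by rewrite Rd /cpair muln_gt0 expn_gt0.
  by solve_regs.
- by have := z d.+3; solve_regs.
- by have := z d.+4; solve_regs.
- by have := z d.+4.+1; solve_regs.
- have z1 : R d.+1 = 0 by apply: z.
  have z2 : R d.+2 = 0 by apply: z; lia.
  by regs_tac.
Qed.

(** Every number codes a list; 0 codes the empty one, and [cpair] forms the codes of the others from
    head and tail. *)
Lemma cpairP n : n = 0 \/ exists a b, n = cpair a b.
Proof.
rewrite -[n]CodeSeq.decodeK; case: (CodeSeq.decode n) => [|a s]; first by left.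
by right; exists a, (CodeSeq.code s).
Qed.

Definition chead n := head 0 (CodeSeq.decode n).
Definition ctail n := CodeSeq.code (behead (CodeSeq.decode n)).

Lemma cpair_code a b : cpair a b = CodeSeq.code (a :: CodeSeq.decode b).
Proof. by rewrite /= CodeSeq.decodeK. Qed.

Lemma chead_cpair a b : chead (cpair a b) = a.
Proof. by rewrite /chead cpair_code CodeSeq.codeK. Qed.

Lemma ctail_cpair a b : ctail (cpair a b) = b.
Proof. by rewrite /ctail cpair_code CodeSeq.codeK /= CodeSeq.decodeK. Qed.

Lemma while_computable_chead : while_computable chead.
Proof.
exists (fun d => CSeq (uncpair d) (CSeq (transfer d [::]) (transfer d.+1 [:: d]))) => d R z.
have z1 := z d.+1 (ltnSn d).
have [R0|[a [b Rd]]] := cpairP (R d).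
  apply: exec_seq (exec_uncpair0 z R0) _; apply: exec_seq (exec_clear _ _) _.
  apply: exec_eq (exec_transfer _ _) _; first by rewrite inE; lia.
  by rewrite R0 (_ : chead 0 = 0) //; regs_tac.
apply: exec_seq (exec_uncpair z Rd) _; apply: exec_seq (exec_clear _ _) _.
apply: exec_eq (exec_transfer _ _) _; first by rewrite inE; lia.
by rewrite Rd chead_cpair; regs_tac.
Qed.

Lemma while_computable_ctail : while_computable ctail.
Proof.
exists (fun d => CSeq (uncpair d) (transfer d.+1 [::])) => d R z.
have z1 := z d.+1 (ltnSn d).
have [R0|[a [b Rd]]] := cpairP (R d).
  apply: exec_seq (exec_uncpair0 z R0) _; apply: exec_eq (exec_clear _ _) _.
  by rewrite R0 (_ : ctail 0 = 0) //; regs_tac.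
apply: exec_seq (exec_uncpair z Rd) _; apply: exec_eq (exec_clear _ _) _.
by rewrite Rd ctail_cpair; regs_tac.
Qed.

(** * Computable functions between countable types *)

(** The function [g] is total, but its values matter on codes only. *)
Definition computable (A B : countType) (f : A -> B) :=
  exists2 g, while_computable g & forall a, g (pickle a) = pickle (f a).

Lemma computable_ext (A B : countType) (f g : A -> B) : f =1 g -> computable f -> computable g.
Proof. by move=> /functional_extensionality ->. Qed.

Lemma computable_id (A : countType) : computable (@id A).
Proof. by exists id; first exact: while_computable_id. Qed.

Lemma computable_comp (X A B : countType) (f : A -> B) (g : X -> A) :
  computable f -> computable g -> computable (fun x => f (g x)).
Proof.
move=> [f' cf Ef] [g' cg Eg]; exists (fun n => f' (g' n)).
  exact: while_computable_comp.
by move=> x; rewrite Eg Ef.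
Qed.

Lemma computable_const (A B : countType) (b : B) : computable (fun _ : A => b).
Proof.
exists (fun _ => pickle b) => //.
elim: (pickle b) => [|n IH]; first exact: while_computable_zero.
exact: while_computable_comp while_computable_succ IH.
Qed.

Lemma computable_pickle (A B : countType) (f : A -> B) :
  computable f -> computable (fun x => pickle (f x)).
Proof. by move=> [g cg Eg]; exists g. Qed.

(** The same [g] serves, since [pickle] is the identity on [nat]. Constructions can therefore be
    carried out on codes. *)
Lemma computable_unpickle (A B : countType) (f : A -> B) :
  computable (fun x => pickle (f x)) -> computable f.
Proof. by move=> [g cg Eg]; exists g. Qed.

Lemma computable_nat (A : countType) (g : nat -> nat) (f : A -> nat) :
  while_computable g -> computable f -> computable (fun x => g (f x)).
Proof. by move=> cg; apply: computable_comp; exists g. Qed.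

Lemma computable_cpair (A : countType) (f g : A -> nat) :
  computable f -> computable g -> computable (fun x => cpair (f x) (g x)).
Proof.
move=> [f' cf Ef] [g' cg Eg]; exists (fun n => cpair (f' n) (g' n)).
  exact: while_computable_cpair.
by move=> x; rewrite Eg Ef.
Qed.

(** A pair is coded as the two-element list of the codes of its components, whence the final 0. *)
Lemma computable_pair (X A B : countType) (f : X -> A) (g : X -> B) :
  computable f -> computable g -> computable (fun x => (f x, g x)).
Proof.
move=> cf cg; apply: computable_unpickle.
apply: (computable_cpair (computable_pickle cf)).
exact: (computable_cpair (computable_pickle cg) (computable_const _ 0)).
Qed.

Lemma computable_comp2 (X A B C : countType) (F : A -> B -> C) (f : X -> A) (g : X -> B) :
  computable (fun p : A * B => F p.1 p.2) -> computable f -> computable g ->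
  computable (fun x => F (f x) (g x)).
Proof. by move=> cF cf cg; apply: computable_comp cF (computable_pair cf cg). Qed.

Lemma computable_comp3 (X A B C D : countType) (F : A -> B -> C -> D)
    (f : X -> A) (g : X -> B) (h : X -> C) :
  computable (fun p : A * B * C => F p.1.1 p.1.2 p.2) ->
  computable f -> computable g -> computable h -> computable (fun x => F (f x) (g x) (h x)).
Proof.
move=> cF cf cg ch.
exact: computable_comp cF (computable_pair (computable_pair cf cg) ch).
Qed.

Lemma computable_fst (X A B : countType) (f : X -> A * B) :
  computable f -> computable (fun x => (f x).1).
Proof.
move=> /computable_pickle/(computable_nat while_computable_chead) cf.
by apply: computable_unpickle; apply: computable_ext cf => x; rewrite chead_cpair.
Qed.

Lemma computable_snd (X A B : countType) (f : X -> A * B) :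
  computable f -> computable (fun x => (f x).2).
Proof.
move=> /computable_pickle/(computable_nat while_computable_ctail).
move=> /(computable_nat while_computable_chead) cf.
apply: computable_unpickle; apply: computable_ext cf => x.
by rewrite ctail_cpair chead_cpair.
Qed.

Lemma computable_iter0 (X B : countType) (n : X -> nat) (F : B -> B) (z : X -> B) :
  computable n -> computable F -> computable z -> computable (fun x => iter (n x) F (z x)).
Proof.
move=> [n' cn En] [F' cF EF] [z' cz Ez]; exists (fun m => iter (n' m) F' (z' m)).
  exact: while_computable_iter.
by move=> x; rewrite En Ez; elim: {En}(n x : nat) => //= k ->.
Qed.

Lemma computable_cons (X A : countType) (f : X -> A) (s : X -> seq A) :
  computable f -> computable s -> computable (fun x => f x :: s x).
Proof.
move=> /computable_pickle cf /computable_pickle cs; apply: computable_unpickle.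
exact: computable_cpair cf cs.
Qed.

(** In [computable_iter0] the iterated function is fixed, so the parameter [x] travels unchanged as
    first component of the state. *)
Lemma computable_iter (X B : countType) (n : X -> nat) (F : X -> B -> B) (z : X -> B) :
  computable n -> computable (fun p : X * B => F p.1 p.2) -> computable z ->
  computable (fun x => iter (n x) (F x) (z x)).
Proof.
move=> cn cF cz.
have c := computable_iter0 cn (computable_pair (computable_fst (computable_id _)) cF)
  (computable_pair (computable_id _) cz).
apply: computable_ext (computable_snd c) => x.
suff -> : forall k, iter k (fun p : X * B => (p.1, F p.1 p.2)) (x, z x) =
  (x, iter k (F x) (z x)) by [].
by elim=> //= k ->.
Qed.

(** Since [pickle] maps booleans to 0 and 1, this is the function with constant value [f x],
    iterated at most once from [g x]. *)
Lemma computable_if (X B : countType) (b : X -> bool) (f g : X -> B) :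
  computable b -> computable f -> computable g ->
  computable (fun x => if b x then f x else g x).
Proof.
move=> cb cf cg.
have cf1 : computable (fun p : X * B => f p.1).
  by apply: (computable_comp cf); apply: computable_fst; apply: computable_id.
have cb' : computable (fun x => nat_of_bool (b x)) by exact: (computable_pickle cb).
apply: computable_ext (computable_iter (F := fun x _ => f x) cb' cf1 cg) => x.
by case: (b x).
Qed.

Lemma computable_eq0 (X : countType) (f : X -> nat) :
  computable f -> computable (fun x => f x == 0).
Proof.
move=> cf; have cF : computable (fun _ : X * bool => false) by apply: computable_const.
have cz : computable (fun _ : X => true) by apply: computable_const.
apply: computable_ext (computable_iter (F := fun _ _ => false) cf cF cz) => x.
by case: (f x).
Qed.

(** Only the empty list has code 0, so the case distinction is a test for 0. The code of
    [(x, t, s')] is assembled from numbers because [T] may be empty, and then no default head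
    exists. *)
Lemma computable_match (X B T : countType) (s : X -> seq T) (f : X -> B) (F : X -> T -> seq T -> B) :
  computable s -> computable f -> computable (fun p : X * T * seq T => F p.1.1 p.1.2 p.2) ->
  computable (fun x => if s x is t :: s' then F x t s' else f x).
Proof.
move=> /computable_pickle cs /computable_pickle cf [F' cF EF]; apply: computable_unpickle.
have c0 : computable (fun _ : X => 0) by apply: computable_const.
have cx : computable (fun x : X => pickle x) by apply/computable_pickle/computable_id.
have ch := computable_nat while_computable_chead cs.
have ct := computable_nat while_computable_ctail cs.
have cxt := computable_cpair cx (computable_cpair ch c0).
have c := computable_nat cF (computable_cpair cxt (computable_cpair ct c0)).
apply: computable_ext (computable_if (computable_eq0 cs) cf c) => x.
case: (s x) => [|t s'] //=.
have e : pickle (t :: s') = cpair (pickle t) (pickle s') by [].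
have -> : (pickle (t :: s') == 0) = false.
  by rewrite e /cpair; apply/negbTE; rewrite -lt0n muln_gt0 expn_gt0.
by rewrite e chead_cpair ctail_cpair -(EF (x, t, s')).
Qed.

(** The step fixes states with an empty list, so surplus iterations are harmless. *)
Lemma iter_foldl (A B : Type) (F : B -> A -> B) n s b : size s <= n ->
  iter n (fun p : seq A * B => if p.1 is t :: s' then (s', F p.2 t) else p) (s, b)
  = ([::], foldl F b s).
Proof.
set G := fun p => _.
elim: s n b => [|t s IH] n b; first by move=> _; elim: n => //= n ->.
by case: n => // n; rewrite ltnS iterSr => /IH ->.
Qed.

(** This makes the code of a list a sufficient number of rounds for a fold, before lengths are known
    to be computable. *)
Lemma leq_size_pickle (A : countType) (s : seq A) : size s <= pickle s.
Proof.
elim: s => //= a s IH; rewrite (_ : pickle _ = cpair (pickle a) (pickle s)) //.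
rewrite /cpair; have := expn_gt0 2 (pickle a); move: (2 ^ _) IH => m; nia.
Qed.

Lemma computable_foldl (X B T : countType) (F : X -> B -> T -> B) (z : X -> B) (s : X -> seq T) :
  computable (fun p : X * B * T => F p.1.1 p.1.2 p.2) -> computable z -> computable s ->
  computable (fun x => foldl (F x) (z x) (s x)).
Proof.
move=> cF cz cs.
have cstep : computable (fun p : X * (seq T * B) =>
    if p.2.1 is t :: s' then (s', F p.1 p.2.2 t) else p.2).
  have cp := computable_id (X * (seq T * B))%type.
  apply: (computable_match (F := fun (p : X * (seq T * B)) t s' => (s', F p.1 p.2.2 t))).
  - exact: computable_fst (computable_snd cp).
  - exact: computable_snd cp.
  - have cq := computable_id (X * (seq T * B) * T * seq T)%type.
    apply: computable_pair; first exact: computable_snd cq.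
    have cq1 := computable_fst (computable_fst cq).
    apply: (computable_comp3 cF); first exact: computable_fst.
    - by do 2 apply: computable_snd.
    - exact: computable_snd (computable_fst cq).
have c := computable_iter (F := fun (x : X) (q : seq T * B) =>
  if q.1 is t :: s' then (s', F x q.2 t) else q) (computable_pickle cs) cstep (computable_pair cs cz).
apply: computable_ext (computable_snd c) => x.
by rewrite (iter_foldl (F x)) // leq_size_pickle.
Qed.

Lemma computable_rev (X T : countType) (s : X -> seq T) :
  computable s -> computable (fun x => rev (s x)).
Proof.
move=> cs; have c : computable (fun p : X * seq T * T => p.2 :: p.1.2).
  have cp := computable_id (X * seq T * T)%type.
  apply: computable_cons; first exact: computable_snd cp.
  exact: computable_snd (computable_fst cp).
apply: computable_ext (computable_foldl (F := fun _ a t => t :: a) c (computable_const _ [::]) cs).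
move=> x; rewrite -[s x in LHS]revK (foldl_rev (fun a t => t :: a)).
by elim: (rev (s x)) => //= t l ->.
Qed.

Lemma computable_foldr (X B T : countType) (F : X -> T -> B -> B) (z : X -> B) (s : X -> seq T) :
  computable (fun p : X * T * B => F p.1.1 p.1.2 p.2) -> computable z -> computable s ->
  computable (fun x => foldr (F x) (z x) (s x)).
Proof.
move=> cF cz cs.
have cF' : computable (fun p : X * B * T => F p.1.1 p.2 p.1.2).
  have cp := computable_id (X * B * T)%type.
  apply: (computable_comp3 cF); last exact: computable_snd (computable_fst cp).
  - exact: computable_fst (computable_fst cp).
  - exact: computable_snd cp.
have c := computable_foldl (F := fun x b t => F x t b) cF' cz (computable_rev cs).
by apply: computable_ext c => x; rewrite foldl_rev.
Qed.

Ltac comp_step := cbv beta; match goal with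
  | |- computable (fun _ => ?c) => apply: computable_const
  | |- computable (fun x => x) => apply: computable_id
  | |- computable fst => exact: (computable_fst (computable_id _))
  | |- computable snd => exact: (computable_snd (computable_id _))
  | H : computable _ |- _ => exact: H
  | H : computable ?f |- computable (fun x => ?f (@?g x)) =>
      apply: (computable_comp (f := f) (g := g) H)
  | |- computable (fun x => (@?f x, @?g x)) => apply: (computable_pair (f := f) (g := g))
  | |- computable (fun x => fst (@?f x)) => apply: (computable_fst (f := f))
  | |- computable (fun x => snd (@?f x)) => apply: (computable_snd (f := f))
  | |- computable (fun x => @?f x :: @?s x) => apply: (computable_cons (f := f) (s := s))
  | _ => apply: computable_if
  end.
Ltac comp := repeat comp_step.

(** * Arithmetic, boolean and list operations *)

Lemma computable_succ (X : countType) (f : X -> nat) :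
  computable f -> computable (fun x => (f x).+1).
Proof. exact: computable_nat while_computable_succ. Qed.

Lemma computable_add (X : countType) (f g : X -> nat) :
  computable f -> computable g -> computable (fun x => f x + g x).
Proof.
move=> cf cg; have cF : computable (fun p : X * nat => p.2.+1) by apply: computable_succ; comp.
apply: computable_ext (computable_iter (F := fun=> succn) cf cF cg) => x.
by rewrite iter_succn addnC.
Qed.

Lemma computable_sub (X : countType) (f g : X -> nat) :
  computable f -> computable g -> computable (fun x => f x - g x).
Proof.
move=> cf cg; have cF : computable (fun p : X * nat => p.2.-1).
  by apply: (computable_nat while_computable_pred); comp.
apply: computable_ext (computable_iter (F := fun=> predn) cg cF cf) => x.
by rewrite iter_predn.
Qed.

(** By definition [m <= n] is [m - n == 0]. *)
Lemma computable_leq (X : countType) (f g : X -> nat) :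
  computable f -> computable g -> computable (fun x => f x <= g x).
Proof. by move=> cf cg; apply: computable_eq0; apply: computable_sub. Qed.

Lemma computable_eqnat (X : countType) (f g : X -> nat) :
  computable f -> computable g -> computable (fun x => f x == g x).
Proof.
move=> cf cg; apply: (@computable_ext _ _ (fun x => if f x <= g x then g x <= f x else false)).
  by move=> x; rewrite eqn_leq; case: leq.
by apply: computable_if; [apply: computable_leq|apply: computable_leq|comp].
Qed.

Lemma computable_eq (X T : countType) (f g : X -> T) :
  computable f -> computable g -> computable (fun x => f x == g x).
Proof.
move=> cf cg; apply: computable_ext (computable_eqnat (computable_pickle cf) (computable_pickle cg)).
move=> x; apply/idP/eqP => [/eqP|->] //.
exact: (pcan_inj pickleK).
Qed.

(** The boolean connectives unfold to conditionals. *)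
Lemma computable_and (X : countType) (f g : X -> bool) :
  computable f -> computable g -> computable (fun x => f x && g x).
Proof. by move=> cf cg; apply: computable_if; comp. Qed.

Lemma computable_or (X : countType) (f g : X -> bool) :
  computable f -> computable g -> computable (fun x => f x || g x).
Proof. by move=> cf cg; apply: computable_if; comp. Qed.

Lemma computable_imply (X : countType) (f g : X -> bool) :
  computable f -> computable g -> computable (fun x => f x ==> g x).
Proof. by move=> cf cg; apply: computable_if; comp. Qed.

Lemma computable_head (X T : countType) d (s : X -> seq T) :
  computable s -> computable (fun x => head d (s x)).
Proof. by move=> cs; apply: (computable_match (F := fun _ t _ => t)); comp. Qed.

Lemma computable_behead (X T : countType) (s : X -> seq T) :
  computable s -> computable (fun x => behead (s x)).
Proof.
move=> cs; apply: (@computable_ext _ _ (fun x => if s x is _ :: s' then s' else [::])).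
  by move=> x; case: (s x).
by apply: (computable_match (F := fun _ _ s' => s')); comp.
Qed.

Lemma computable_nth (X T : countType) d (s : X -> seq T) (n : X -> nat) :
  computable s -> computable n -> computable (fun x => nth d (s x) (n x)).
Proof.
move=> cs cn; apply: (@computable_ext _ _ (fun x => head d (iter (n x) behead (s x)))).
  by move=> x; rewrite -drop_behead -nth0 nth_drop addn0.
apply: computable_head; apply: (computable_iter (F := fun=> behead)) => //.
by apply: computable_behead; comp.
Qed.

Lemma computable_size (X T : countType) (s : X -> seq T) :
  computable s -> computable (fun x => size (s x)).
Proof.
move=> cs; have cF : computable (fun p : X * T * nat => p.2.+1) by apply: computable_succ; comp.
apply: computable_ext (computable_foldr (F := fun _ _ => succn) cF (computable_const _ 0) cs).
by move=> x; elim: (s x) => //= t l ->.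
Qed.

Lemma computable_cat (X T : countType) (s1 s2 : X -> seq T) :
  computable s1 -> computable s2 -> computable (fun x => s1 x ++ s2 x).
Proof.
move=> cs1 cs2; have cF : computable (fun p : X * T * seq T => p.1.2 :: p.2) by comp.
apply: computable_ext (computable_foldr (F := fun _ => cons) cF cs2 cs1) => x.
by elim: (s1 x) => //= t l ->.
Qed.

Lemma computable_rcons (X T : countType) (s : X -> seq T) (f : X -> T) :
  computable s -> computable f -> computable (fun x => rcons (s x) (f x)).
Proof.
move=> cs cf; apply: (@computable_ext _ _ (fun x => s x ++ [:: f x])).
  by move=> x; rewrite cats1.
by apply: computable_cat; comp.
Qed.

Lemma computable_map (X B T : countType) (F : X -> T -> B) (s : X -> seq T) :
  computable (fun p : X * T => F p.1 p.2) -> computable s ->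
  computable (fun x => [seq F x t | t <- s x]).
Proof.
move=> cF cs; have cG : computable (fun p : X * T * seq B => F p.1.1 p.1.2 :: p.2).
  by apply: computable_cons; [apply: (computable_comp2 cF); comp|comp].
apply: computable_ext (computable_foldr (F := fun x t l => F x t :: l) cG (computable_const _ [::]) cs).
by move=> x; elim: (s x) => //= t l ->.
Qed.

Lemma computable_filter (X T : countType) (F : X -> T -> bool) (s : X -> seq T) :
  computable (fun p : X * T => F p.1 p.2) -> computable s ->
  computable (fun x => [seq t <- s x | F x t]).
Proof.
move=> cF cs.
have cG : computable (fun p : X * T * seq T => if F p.1.1 p.1.2 then p.1.2 :: p.2 else p.2).
  apply: computable_if; [|comp|comp].
  by apply: (computable_comp2 cF); comp.
apply: computable_ext (computable_foldr (F := fun x t l => if F x t then t :: l else l)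
  cG (computable_const _ [::]) cs).
by move=> x; elim: (s x) => //= t l ->.
Qed.

Lemma computable_has (X T : countType) (F : X -> T -> bool) (s : X -> seq T) :
  computable (fun p : X * T => F p.1 p.2) -> computable s ->
  computable (fun x => has (F x) (s x)).
Proof.
move=> cF cs; have cG : computable (fun p : X * T * bool => F p.1.1 p.1.2 || p.2).
  by apply: computable_or; [apply: (computable_comp2 cF); comp|comp].
apply: computable_ext (computable_foldr (F := fun x t l => F x t || l) cG (computable_const _ false) cs).
by move=> x; elim: (s x) => //= t l ->.
Qed.

Lemma computable_all (X T : countType) (F : X -> T -> bool) (s : X -> seq T) :
  computable (fun p : X * T => F p.1 p.2) -> computable s ->
  computable (fun x => all (F x) (s x)).
Proof.
move=> cF cs; have cG : computable (fun p : X * T * bool => F p.1.1 p.1.2 && p.2).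
  by apply: computable_and; [apply: (computable_comp2 cF); comp|comp].
apply: computable_ext (computable_foldr (F := fun x t l => F x t && l) cG (computable_const _ true) cs).
by move=> x; elim: (s x) => //= t l ->.
Qed.

Lemma computable_sumn (X : countType) (s : X -> seq nat) :
  computable s -> computable (fun x => sumn (s x)).
Proof.
move=> cs; apply: (computable_foldr (F := fun=> addn)) => //; comp.
by apply: computable_add; comp.
Qed.

Lemma computable_mul (X : countType) (f g : X -> nat) :
  computable f -> computable g -> computable (fun x => f x * g x).
Proof.
move=> cf cg; apply: (@computable_ext _ _ (fun x => iter (f x) (addn (g x)) 0)).
  by move=> x; rewrite iter_addn_0 mulnC.
apply: (computable_iter (F := fun x => addn (g x))) => //; comp.
by apply: computable_add; [apply: (computable_comp cg)|]; comp.
Qed.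

Lemma computable_exp (X : countType) m (f : X -> nat) :
  computable f -> computable (fun x => m ^ f x).
Proof.
move=> cf; apply: (@computable_ext _ _ (fun x => iter (f x) (muln m) 1)).
  by move=> x; rewrite iter_muln_1.
apply: (computable_iter (F := fun=> muln m)) => //; comp.
by apply: computable_mul; comp.
Qed.

Lemma computable_mem (X T : countType) (f : X -> T) (s : X -> seq T) :
  computable f -> computable s -> computable (fun x => f x \in s x).
Proof.
move=> cf cs; apply: (@computable_ext _ _ (fun x => has (fun t => t == f x) (s x))).
  by move=> x; rewrite -has_pred1.
apply: (computable_has (F := fun x t => t == f x)) => //.
by apply: computable_eq; [|apply: (computable_comp cf)]; comp.
Qed.

Lemma computable_index (X T : countType) (f : X -> T) (s : X -> seq T) :
  computable f -> computable s -> computable (fun x => index (f x) (s x)).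
Proof.
move=> cf cs; have cG : computable (fun p : X * T * nat => if p.1.2 == f p.1.1 then 0 else p.2.+1).
  apply: computable_if; [|comp|by apply: computable_succ; comp].
  by apply: computable_eq; [|apply: (computable_comp cf)]; comp.
apply: computable_ext (computable_foldr (F := fun x t l => if t == f x then 0 else l.+1)
  cG (computable_const _ 0) cs).
by move=> x; rewrite /index; elim: (s x) => //= t l ->.
Qed.

Lemma computable_flatten (X T : countType) (s : X -> seq (seq T)) :
  computable s -> computable (fun x => flatten (s x)).
Proof.
move=> cs; apply: (computable_foldr (F := fun=> cat)) => //; comp.
by apply: computable_cat; comp.
Qed.

Lemma computable_iota (X : countType) (f : X -> nat) :
  computable f -> computable (fun x => iota 0 (f x)).
Proof.
move=> cf; apply: (@computable_ext _ _ (fun x => iter (f x) (fun s => rcons s (size s)) [::])).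
  move=> x; elim: (f x) => // n IH.
  by rewrite iterS IH size_iota -[in RHS]addn1 iotaD cats1.
apply: (computable_iter (F := fun=> fun s => rcons s (size s))) => //; comp.
by apply: computable_rcons; [|apply: computable_size]; comp.
Qed.

(** This reduces the update to [map]. When [n] lies past the end, the padding by [d] comes from the
    default of [nth]. *)
Lemma set_nth_map_iota (T : Type) d (s : seq T) n y :
  set_nth d s n y =
  [seq if i == n then y else nth d s i | i <- iota 0 (if n.+1 < size s then size s else n.+1)].
Proof.
apply: (@eq_from_nth _ d); first by rewrite size_set_nth size_map size_iota.
move=> i; rewrite size_set_nth => isz.
by rewrite (nth_map 0) ?size_iota // nth_iota // nth_set_nth.
Qed.

Lemma computable_set_nth (X T : countType) d (s : X -> seq T) (n : X -> nat) (f : X -> T) :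
  computable s -> computable n -> computable f ->
  computable (fun x => set_nth d (s x) (n x) (f x)).
Proof.
move=> cs cn cf; apply: (@computable_ext _ _ _ _ (fun x => esym (set_nth_map_iota d (s x) (n x) (f x)))).
apply: (computable_map (F := fun x i => if i == n x then f x else nth d (s x) i)).
  apply: computable_if; last 2 first.
  - by apply: (computable_comp cf); comp.
  - by apply: computable_nth; [apply: (computable_comp cs)|]; comp.
  by apply: computable_eq; [|apply: (computable_comp cn)]; comp.
have csz := computable_size cs; have cS := computable_succ cn.
by apply: computable_iota; apply: computable_if => //; apply: computable_leq => //; apply: computable_succ.
Qed.

(** * The decision procedure *)

Definition nfa0 : nfa := (0, [::], [::], [::]).

Definition in_productb (prd : seq nfa) (C : chans) :=
  all (fun xi => nfa_accepts (nth nfa0 prd xi) (nth [::] C xi)) (iota 0 (size prd)).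

Definition in_recb (D : recdesc) (C : chans) := has (fun prd => in_productb prd C) D.

Definition t_src (t : transition) : nat := t.1.1.
Definition t_send (t : transition) : bool := t.1.2.1.1.
Definition t_edge (t : transition) : nat := t.1.2.1.2.
Definition t_msg (t : transition) : nat := t.1.2.2.
Definition t_dst (t : transition) : nat := t.2.

(** Comparison with [behead] tests the first letter without a default message and fails on the empty
    word. *)
Definition enabled (S : cstate) (C : chans) j t :=
  (nth 0 S j == t_src t) &&
  (t_send t || (nth [::] C (t_edge t) == t_msg t :: behead (nth [::] C (t_edge t)))).

Definition fire (C : chans) t : chans :=
  let w := nth [::] C (t_edge t) in
  set_nth [::] C (t_edge t) (if t_send t then rcons w (t_msg t) else behead w).

Definition closed_at (P : protocol) (F : Defs.family) (C : chans) :=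
  all (fun e : cstate * recdesc => in_recb e.2 C ==>
    all (fun j => all (fun t => enabled e.1 C j t ==>
        in_recb (fam_lookup F (set_nth 0 e.1 j (t_dst t))) (fire C t))
      (trans (mach P j))) (iota 0 (nnodes P))) F.

Definition valid_chansb (P : protocol) (C : chans) :=
  all (fun xi => all (fun k => k < msgcount P xi) (nth [::] C xi)) (iota 0 (nedges P)).

Definition strings (T : Type) (alph : seq T) n :=
  iter n (fun L => flatten [seq [seq a :: w | w <- L] | a <- alph]) [:: [::]].

Definition strings_upto (T : Type) (alph : seq T) n :=
  flatten [seq strings alph i | i <- iota 0 n.+1].

Definition nfas (F : Defs.family) : seq nfa := flatten (flatten [seq e.2 | e <- F]).

Definition nstates_bound (F : Defs.family) := sumn [seq nfa_nstates A | A <- nfas F].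

(* Number of families of binary relations on the states, one relation per automaton. *)
Definition length_bound (F : Defs.family) :=
  2 ^ (size (nfas F) * (nstates_bound F * nstates_bound F)).

(** [strings] is used twice: for words over one alphabet large enough for every edge, and, with
    these words as letters, for channel contents. [valid_chansb] discards those with a letter
    outside the message set of its edge. *)
Definition consistentb (x : instance) :=
  all (fun C => valid_chansb x.1 C ==> closed_at x.1 x.2 C)
    (strings (strings_upto (iota 0 (sumn x.1.1.2)) (length_bound x.2)) (nedges x.1)).

(** * Computability of the decision procedure *)

Lemma computable_nfa_next (X : countType) (A : X -> nfa) (s : X -> seq nat) (a : X -> nat) :
  computable A -> computable s -> computable a ->
  computable (fun x => nfa_next (A x) (s x) (a x)).
Proof.
move=> cA cs ca; apply: (computable_map (F := fun _ t => t.2)); first by comp.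
apply: (computable_filter (F := fun x (t : nat * nat * nat) => (t.1.1 \in s x) && (t.1.2 == a x))).
  by apply: computable_and; [apply: computable_mem|apply: computable_eq]; comp.
by rewrite /nfa_trans; comp.
Qed.

Lemma computable_nfa_accepts (X : countType) (A : X -> nfa) (w : X -> seq nat) :
  computable A -> computable w -> computable (fun x => nfa_accepts (A x) (w x)).
Proof.
move=> cA cw; apply: (computable_has (F := fun x q => q \in nfa_final (A x))).
  by apply: computable_mem; rewrite /nfa_final; comp.
apply: (computable_foldl (F := fun x => nfa_next (A x))) => //.
  by apply: computable_nfa_next; comp.
by rewrite /nfa_init; comp.
Qed.

Lemma computable_in_recb (X : countType) (D : X -> recdesc) (C : X -> chans) :
  computable D -> computable C -> computable (fun x => in_recb (D x) (C x)).
Proof.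
move=> cD cC; apply: (computable_has (F := fun x prd => in_productb prd (C x))) => //.
apply: (computable_all (F := fun (p : X * seq nfa) xi =>
   nfa_accepts (nth nfa0 p.2 xi) (nth [::] (C p.1) xi))).
  by apply: computable_nfa_accepts; apply: computable_nth; comp.
by apply: computable_iota; apply: computable_size; comp.
Qed.

Lemma computable_fam_lookup (X : countType) (F : X -> Defs.family) (S : X -> cstate) :
  computable F -> computable S -> computable (fun x => fam_lookup (F x) (S x)).
Proof.
move=> cF cS; apply: computable_nth.
  by apply: (computable_map (F := fun _ e => e.2)); comp.
apply: computable_index => //.
by apply: (computable_map (F := fun _ e => e.1)); comp.
Qed.

Lemma computable_enabled (X : countType) (S : X -> cstate) (C : X -> chans) (j : X -> nat)
    (t : X -> transition) :
  computable S -> computable C -> computable j -> computable t ->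
  computable (fun x => enabled (S x) (C x) (j x) (t x)).
Proof.
move=> cS cC cj ct; rewrite /enabled /t_src /t_send /t_edge /t_msg.
have cw : computable (fun x => nth [::] (C x) (t x).1.2.1.2) by apply: computable_nth; comp.
apply: computable_and.
  by apply: computable_eq; [apply: computable_nth|]; comp.
apply: computable_or; first by comp.
apply: computable_eq => //; apply: computable_cons; first by comp.
exact: computable_behead.
Qed.

Lemma computable_fire (X : countType) (C : X -> chans) (t : X -> transition) :
  computable C -> computable t -> computable (fun x => fire (C x) (t x)).
Proof.
move=> cC ct; rewrite /fire /t_send /t_edge /t_msg.
have cw : computable (fun x => nth [::] (C x) (t x).1.2.1.2) by apply: computable_nth; comp.
apply: computable_set_nth; [by comp|by comp|].
by apply: computable_if; [comp|apply: computable_rcons|apply: computable_behead]; comp.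
Qed.

Lemma computable_closed_at (X : countType) (P : X -> protocol) (F : X -> Defs.family)
    (C : X -> chans) :
  computable P -> computable F -> computable C ->
  computable (fun x => closed_at (P x) (F x) (C x)).
Proof.
move=> cP cF cC.
apply: (computable_all (F := fun x (e : cstate * recdesc) => in_recb e.2 (C x) ==>
    all (fun j => all (fun t => enabled e.1 (C x) j t ==>
        in_recb (fam_lookup (F x) (set_nth 0 e.1 j (t_dst t))) (fire (C x) t))
      (trans (mach (P x) j))) (iota 0 (nnodes (P x))))) => //.
apply: computable_imply; first by apply: computable_in_recb; comp.
apply: (computable_all (F := fun (p : X * (cstate * recdesc)) j =>
    all (fun t => enabled p.2.1 (C p.1) j t ==>
        in_recb (fam_lookup (F p.1) (set_nth 0 p.2.1 j (t_dst t))) (fire (C p.1) t))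
      (trans (mach (P p.1) j)))); last first.
  by rewrite /nnodes /machines; apply: computable_iota; apply: computable_size; comp.
apply: (computable_all (F := fun (p : X * (cstate * recdesc) * nat) t =>
    enabled p.1.2.1 (C p.1.1) p.2 t ==>
        in_recb (fam_lookup (F p.1.1) (set_nth 0 p.1.2.1 p.2 (t_dst t))) (fire (C p.1.1) t)));
  last first.
  rewrite /trans /mach /machines; apply: computable_snd; apply: computable_nth; comp.
apply: computable_imply; first by apply: computable_enabled; comp.
apply: computable_in_recb; last by apply: computable_fire; comp.
apply: computable_fam_lookup; first by comp.
by rewrite /t_dst; apply: computable_set_nth; comp.
Qed.

Lemma computable_strings (X T : countType) (alph : X -> seq T) (n : X -> nat) :
  computable alph -> computable n -> computable (fun x => strings (alph x) (n x)).
Proof.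
move=> ca cn; apply: (computable_iter (F := fun x L =>
  flatten [seq [seq a :: w | w <- L] | a <- alph x])) => //; last by comp.
apply: computable_flatten.
apply: (computable_map (F := fun (p : X * seq (seq T)) a => [seq a :: w | w <- p.2])); last by comp.
by apply: (computable_map (F := fun (p : X * seq (seq T) * T) w => p.2 :: w)); comp.
Qed.

Lemma computable_strings_upto (X T : countType) (alph : X -> seq T) (n : X -> nat) :
  computable alph -> computable n -> computable (fun x => strings_upto (alph x) (n x)).
Proof.
move=> ca cn; apply: computable_flatten.
apply: (computable_map (F := fun x i => strings (alph x) i)).
  by apply: computable_strings; comp.
by apply: computable_iota; apply: computable_succ.
Qed.

Lemma computable_length_bound (X : countType) (F : X -> Defs.family) :
  computable F -> computable (fun x => length_bound (F x)).
Proof.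
move=> cF; have cn : computable (fun x => nfas (F x)).
  do 2 apply: computable_flatten.
  by apply: (computable_map (F := fun _ e => e.2)); comp.
have cN : computable (fun x => nstates_bound (F x)).
  apply: computable_sumn; apply: (computable_map (F := fun _ A => nfa_nstates A)) => //.
  by rewrite /nfa_nstates; comp.
apply: computable_exp; apply: computable_mul; last exact: computable_mul.
exact: computable_size.
Qed.

Lemma computable_consistentb : computable consistentb.
Proof.
have c1 : computable (fun x : instance => x.1) by comp.
have c2 : computable (fun x : instance => x.2) by comp.
apply: (computable_all (F := fun (x : instance) C => valid_chansb x.1 C ==> closed_at x.1 x.2 C)).
  apply: computable_imply; last by apply: computable_closed_at; comp.
  apply: (computable_all (F := fun (p : instance * chans) xi =>
    all (fun k => k < msgcount p.1.1 xi) (nth [::] p.2 xi))).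
    apply: (computable_all (F := fun (p : instance * chans * nat) k => k < msgcount p.1.1.1 p.2)).
      rewrite /msgcount; apply: computable_leq; first by apply: computable_succ; comp.
      by apply: computable_nth; comp.
    by apply: computable_nth; comp.
  by rewrite /nedges /edges; apply: computable_iota; apply: computable_size; comp.
apply: computable_strings; last by rewrite /nedges /edges; apply: computable_size; comp.
apply: computable_strings_upto; last exact: computable_length_bound.
by apply: computable_iota; apply: computable_sumn; comp.
Qed.

(** * Correctness of the decision procedure *)

Lemma in_recP D C : reflect (in_rec D C) (in_recb D C).
Proof.
have prodP prd : reflect (in_product prd C) (in_productb prd C).
  apply: (iffP allP) => [H xi xis|H xi]; first by apply: H; rewrite mem_iota.
  by rewrite mem_iota => /H.
by apply: (iffP hasP) => -[prd prdD /prodP]; exists prd.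
Qed.

(** * Words acting on the states of automata *)

Definition nfa_run A := foldl (nfa_next A).

Lemma mem_nfa_next A X a q :
  (q \in nfa_next A X a) = has (fun p => (p, a, q) \in nfa_trans A) X.
Proof.
apply/mapP/hasP => [[[[p b] r]]|[p pX pq]].
  by rewrite mem_filter /= => /andP[/andP[pX /eqP->] tA] ->; exists p.
by exists (p, a, q) => //; rewrite mem_filter /= pX eqxx.
Qed.

(** A run from a set is the union of the runs from its points, so the action of a word is a binary
    relation on states. *)
Lemma mem_nfa_run A X w q :
  (q \in nfa_run A X w) = has (fun p => q \in nfa_run A [:: p] w) X.
Proof.
elim: w X => [|a w IH] X /=.
  by rewrite -has_pred1; apply: eq_has => p; rewrite /= inE eq_sym.
rewrite IH; apply/hasP/hasP => [[r]|[p pX]].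
  rewrite mem_nfa_next => /hasP[p pX pr] rq; exists p => //.
  by rewrite IH; apply/hasP; exists r => //; rewrite mem_nfa_next /= pr.
rewrite IH => /hasP[r]; rewrite mem_nfa_next /= orbF => pr rq.
by exists r => //; rewrite mem_nfa_next; apply/hasP; exists p.
Qed.

Definition nfa_bounded N (A : nfa) :=
  all (fun q => q < N) (nfa_init A) && all (fun t => t.2 < N) (nfa_trans A).

Lemma nfa_next_bounded N A X a : nfa_bounded N A -> all (fun q => q < N) (nfa_next A X a).
Proof.
case/andP=> _ /allP tN; apply/allP => q; rewrite mem_nfa_next => /hasP[p _ /tN].
by [].
Qed.

Lemma nfa_run_bounded N A X w : nfa_bounded N A -> all (fun q => q < N) X ->
  all (fun q => q < N) (nfa_run A X w).
Proof. by move=> bA; elim: w X => //= a w IH X _; apply: IH; apply: nfa_next_bounded. Qed.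

Section Signature.
Variables (L : seq nfa) (N : nat).
Hypothesis bL : all (nfa_bounded N) L.

(* The transition relations that a word induces on the automata of [L]. *)
Definition signature w : {ffun 'I_(size L) * ('I_N * 'I_N) -> bool} :=
  [ffun z : 'I_(size L) * ('I_N * 'I_N) =>
     val z.2.2 \in nfa_run (nth nfa0 L z.1) [:: val z.2.1] w].

Lemma signature_run A X w w' : A \in L -> all (fun q => q < N) X ->
  signature w = signature w' -> nfa_run A X w =i nfa_run A X w'.
Proof.
move=> AL bX /ffunP E q; rewrite !mem_nfa_run; apply: eq_in_has => p /(allP bX) pN.
have bA : nfa_bounded N A := allP bL _ AL.
have [qN|Nq] := boolP (q < N).
  have iL : index A L < size L by rewrite index_mem.
  by have := E (Ordinal iL, (Ordinal pN, Ordinal qN)); rewrite !ffunE /= nth_index.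
have no v : (q \in nfa_run A [:: p] v) = false.
  have bp : all (fun q => q < N) [:: p] by rewrite /= pN.
  by apply/negP => /(allP (nfa_run_bounded v bA bp)); apply/negP.
by rewrite !no.
Qed.

(** Singletons suffice as test sets. With [signature_run], equal signatures amount to equal actions
    on all sets of states below [N], from which compatibility with concatenation follows. *)
Lemma signature_of_run w w' :
  (forall A X, A \in L -> all (fun q => q < N) X -> nfa_run A X w =i nfa_run A X w') ->
  signature w = signature w'.
Proof.
move=> H; apply/ffunP => -[i [p q]]; rewrite !ffunE /= H ?mem_nth //=.
by rewrite ltn_ord.
Qed.

Lemma nfa_run_eqi A X Y w : X =i Y -> nfa_run A X w =i nfa_run A Y w.
Proof. by move=> XY q; rewrite !mem_nfa_run; apply: eq_has_r. Qed.

Lemma signature_cat u u' v :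
  signature u = signature u' -> signature (u ++ v) = signature (u' ++ v).
Proof.
move=> E; apply: signature_of_run => A X AL bX q; rewrite /nfa_run !foldl_cat.
by apply: nfa_run_eqi => r; apply: signature_run.
Qed.

Lemma signature_cons k w w' :
  signature w = signature w' -> signature (k :: w) = signature (k :: w').
Proof.
move=> E; apply: signature_of_run => A X AL bX q /=.
by apply: signature_run => //; apply: nfa_next_bounded; apply: (allP bL).
Qed.

Lemma signature_accepts A w w' : A \in L ->
  signature w = signature w' -> nfa_accepts A w = nfa_accepts A w'.
Proof.
move=> AL E; apply: eq_has_r; apply: signature_run => //.
by case/andP: (allP bL _ AL).
Qed.

(* Pigeonhole: two prefixes of a long word have the same signature, and the
   factor between them can be removed. *)
Lemma signature_shrink w : exists w',
  [/\ size w' < 2 ^ (size L * (N * N)), {subset w' <= w} & signature w' = signature w].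
Proof.
set K := 2 ^ _.
have cardK : #|{ffun 'I_(size L) * ('I_N * 'I_N) -> bool}| = K.
  by rewrite card_ffun card_bool !card_prod !card_ord.
have [n] := ubnP (size w); elim: n w => // n IH w /ltnSE wn.
have [wK|Kw] := ltnP (size w) K; first by exists w; split.
(* Counting the empty and the full one, there are [size w + 1] prefixes, more than the [K]
   signatures. *)
pose f (i : 'I_(size w).+1) := signature (take i w).
have /injectivePn[i [j ij Ef]] : ~~ injectiveb f.
  apply/negP => /injectiveP/leq_card; rewrite card_ord cardK; lia.
wlog lij : i j ij Ef / i < j.
  move=> H; have [lij|lji] := orP (etrans (esym (neq_ltn i j)) ij).
    exact: (H i j ij Ef lij).
  by apply: (H j i _ (esym Ef) lji); rewrite eq_sym.
have E : signature (take i w ++ drop j w) = signature w.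
  by rewrite -[w in RHS](cat_take_drop j); apply: signature_cat.
have jw : j <= size w by rewrite -ltnS.
have [|w' [sw' w'w sigw']] := IH (take i w ++ drop j w).
  rewrite size_cat size_take_min size_drop; lia.
exists w'; split => //; last by rewrite sigw'.
move=> a /w'w; rewrite mem_cat => /orP[]; [exact: mem_take|exact: mem_drop].
Qed.

(** All that one step and the two membership tests around it can observe: the word itself, its
    remainder after a receive, and its first letter, which decides whether a receive is enabled. *)
Definition similar (w w' : seq nat) :=
  [/\ signature w = signature w', signature (behead w) = signature (behead w') &
      forall k, (w == k :: behead w) = (w' == k :: behead w')].

(** The first letter is kept and the rest shrunk; the strict bound for the rest leaves room for that
    letter. *)
Lemma similar_shrink w : exists w',
  [/\ size w' <= 2 ^ (size L * (N * N)), {subset w' <= w} & similar w w'].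
Proof.
case: w => [|k w]; first by exists [::].
have [w' [sw' sub E]] := signature_shrink w; exists (k :: w'); split => //.
- by move=> a; rewrite !inE => /orP[->//|/sub ->]; rewrite orbT.
- by split => //=; [apply: signature_cons|move=> l; rewrite !eqseq_cons !eqxx].
Qed.

Lemma similar_shrink_seq (C : chans) : exists C',
  [/\ size C' = size C,
      (forall xi, size (nth [::] C' xi) <= 2 ^ (size L * (N * N))),
      (forall xi, {subset nth [::] C' xi <= nth [::] C xi}) &
      (forall xi, similar (nth [::] C xi) (nth [::] C' xi))].
Proof.
elim: C => [|w C [C' [s1 s2 s3 s4]]].
  by exists [::]; split => // xi; rewrite ?nth_nil.
have [w' [r2 r3 r4]] := similar_shrink w.
by exists (w' :: C'); split => [|[|xi]|[|xi]|[|xi]] //=; rewrite s1.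
Qed.

Lemma in_recb_signature (D : recdesc) (C C' : chans) :
  (forall prd A, prd \in D -> A \in prd -> A \in L) ->
  (forall xi, signature (nth [::] C xi) = signature (nth [::] C' xi)) ->
  in_recb D C = in_recb D C'.
Proof.
move=> DL E; apply: eq_in_has => prd prdD; apply: eq_in_all => xi.
rewrite mem_iota /= => xis; apply: signature_accepts => //.
by apply: DL prdD _; apply: mem_nth.
Qed.

Lemma enabled_similar S C C' j t :
  (forall xi, similar (nth [::] C xi) (nth [::] C' xi)) ->
  enabled S C j t = enabled S C' j t.
Proof. by move=> E; rewrite /enabled; case: (E (t_edge t)) => _ _ ->. Qed.

(** A send extends the word on the right, which respects signatures; a receive leaves the tail,
    whose signature is part of [similar]. *)
Lemma fire_similar C C' t xi :
  (forall xi, similar (nth [::] C xi) (nth [::] C' xi)) ->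
  signature (nth [::] (fire C t) xi) = signature (nth [::] (fire C' t) xi).
Proof.
move=> E; rewrite /fire !nth_set_nth /=; case: eqP => _; last by case: (E xi).
case: (E (t_edge t)) => E1 E2 _; case: (t_send t) => //.
by rewrite -!cats1; apply: signature_cat.
Qed.

End Signature.

Lemma closed_at_similar P F C C' N : all (nfa_bounded N) (nfas F) ->
  (forall xi, similar (nfas F) N (nth [::] C xi) (nth [::] C' xi)) ->
  closed_at P F C = closed_at P F C'.
Proof.
move=> bF E.
have memL e prd A : e \in F -> prd \in e.2 -> A \in prd -> A \in nfas F.
  move=> eF prde Aprd; apply/flattenP; exists prd => //.
  by apply/flattenP; exists e.2 => //; apply: map_f.
apply: eq_in_all => e eF; congr implb.
  apply: (in_recb_signature bF); first by move=> prd A; apply: memL.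
  by move=> xi; case: (E xi).
apply: eq_all => j; apply: eq_all => t; rewrite (enabled_similar _ _ _ E); congr implb.
apply: (in_recb_signature bF); last by move=> xi; apply: fire_similar.
move=> prd A; rewrite /fam_lookup.
(* A composite state missing from the table is looked up as the empty union, which contains no
   automaton. *)
set i := index _ _; have [iF|Fi] := ltnP i (size F); last first.
  by rewrite nth_default // size_map.
rewrite (nth_map ([::], [::])) // => prdi Aprd.
by apply: memL prdi Aprd; apply: mem_nth.
Qed.

Lemma mem_strings (T : eqType) (alph : seq T) n s :
  (s \in strings alph n) = (size s == n) && all (mem alph) s.
Proof.
elim: n s => [|n IH] s; first by rewrite inE; case: s.
rewrite /strings iterS -/(strings alph n); apply/flattenP/idP => [[l /mapP[a aA ->]]|].
  by case/mapP=> w; rewrite IH => /andP[/eqP<- wA] -> /=; rewrite eqxx aA.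
case: s => // a w /= /and3P[sw aA wA].
exists [seq a :: w | w <- strings alph n]; first exact: map_f.
by apply: map_f; rewrite IH; apply/andP.
Qed.

Lemma mem_strings_upto (T : eqType) (alph : seq T) n s :
  (s \in strings_upto alph n) = (size s <= n) && all (mem alph) s.
Proof.
apply/flattenP/idP => [[l /mapP[i]]|/andP[sn sA]].
  by rewrite mem_iota ltnS /= => ile ->; rewrite mem_strings => /andP[/eqP->]; rewrite ile.
exists (strings alph (size s)); last by rewrite mem_strings eqxx.
by apply: map_f; rewrite mem_iota.
Qed.

Lemma leq_sumn (s : seq nat) n : n \in s -> n <= sumn s.
Proof.
elim: s => //= m s IH; rewrite inE => /orP[/eqP->|/IH]; first exact: leq_addr.
by move/leq_trans; apply; apply: leq_addl.
Qed.

(** * Soundness and completeness of the search *)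

Section Correctness.
Variables (P : protocol) (F : Defs.family).
Hypotheses (wfP : wf_protocol P) (wfF : wf_family P F).

Lemma nfas_bounded : all (nfa_bounded (nstates_bound F)) (nfas F).
Proof.
case: wfF => _ _ _ wfF4; apply/allP => A AF.
have nA : nfa_nstates A <= nstates_bound F by apply: leq_sumn; apply: map_f.
have /flattenP[prd /flattenP[D /mapP[e eF ->] prde] Aprd] := AF.
(* Well-formedness is stated per edge, so [A] is located by its index in the product. *)
have [sz /(_ (index A prd))] := wfF4 e eF prd prde.
rewrite -sz index_mem nth_index // => /(_ Aprd) /and3P[iA _ tA].
apply/andP; split; first by apply: sub_all iA => q /leq_trans; apply.
by apply: sub_all tA => t /and3P[_ /leq_trans lt _]; apply: lt.
Qed.

Lemma msgcount_le xi : msgcount P xi <= sumn P.1.2.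
Proof.
rewrite /msgcount; have [xis|sxi] := ltnP xi (size P.1.2); last by rewrite nth_default.
by apply: leq_sumn; apply: mem_nth.
Qed.

Lemma valid_chansP C : size C = nedges P -> reflect (valid_chans P C) (valid_chansb P C).
Proof.
move=> sC; apply: (iffP allP) => [H|[_ H] xi]; last by rewrite mem_iota => /H.
by split => // xi xis; apply: H; rewrite mem_iota.
Qed.

(** An arbitrary content is replaced by a similar short one. The letters of the latter come from the
    former, so it is valid and among the contents searched. *)
Lemma consistentb_closed C : consistentb (P, F) -> valid_chans P C -> closed_at P F C.
Proof.
move=> /allP cons [sC vC].
have [C' [s1 s2 s3 s4]] := similar_shrink_seq nfas_bounded C.
rewrite (closed_at_similar P nfas_bounded s4).
have vC' xi : xi < nedges P -> all (fun k => k < msgcount P xi) (nth [::] C' xi).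
  by move=> xis; apply/allP => k /s3; apply: (allP (vC xi xis)).
have /cons /implyP : C' \in strings (strings_upto (iota 0 (sumn P.1.2)) (length_bound F)) (nedges P).
  rewrite mem_strings s1 sC eqxx; apply/(all_nthP [::]) => xi; rewrite s1 sC => xis.
  rewrite inE mem_strings_upto s2; apply/allP => k /(allP (vC' xi xis)) kM.
  by rewrite inE mem_iota /=; apply: leq_trans kM (msgcount_le xi).
by apply; apply/valid_chansP; [rewrite s1|split; rewrite ?s1].
Qed.

Lemma fam_lookup_mem e : e \in F -> fam_lookup F e.1 = e.2.
Proof.
case: wfF => uF _ _ _ eF; rewrite /fam_lookup.
have iF : index e F < size F by rewrite index_mem.
have := nth_index e eF; set i := index e F in iF *; move=> ei.
have -> : e.1 = nth e.1 (map fst F) i by rewrite (nth_map e) // ei.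
by rewrite index_uniq ?size_map // (nth_map e) // ei.
Qed.

Lemma valid_step S C S' C' : valid_cstate P S -> valid_chans P C ->
  step P (S, C) (S', C') -> valid_cstate P S' /\ valid_chans P C'.
Proof.
move=> [sS vS] [sC vC] [j [jn [p [s [xi [k [q [tT [Sj [-> [xiE st]]]]]]]]]]].
have [_ _ /(_ j jn) [_ /allP /(_ _ tT)]] := wfP.
case/and5P=> _ qn _ km _; split.
  split; first by rewrite size_set_nth sS; apply/maxn_idPr.
  by move=> i iN; rewrite nth_set_nth /=; case: eqP => [->|_]; last exact: vS.
have [w [-> vw]] : exists w, C' = set_nth [::] C xi w /\ all (fun k => k < msgcount P xi) w.
  case: s tT st => _ => [[_ ->]|[_ [rest [Cxi ->]]]].
    by eexists; split; first by []; rewrite all_rcons km vC.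
  by exists rest; split => //; have := vC xi xiE; rewrite Cxi => /andP[].
split; first by rewrite size_set_nth sC; apply/maxn_idPr.
by move=> eta etaE; rewrite nth_set_nth /=; case: eqP => [->|_]; last exact: vC.
Qed.

(** Induction along the computation. Validity is carried along by [valid_step], since closure is
    known at valid contents only. *)
Lemma consistentb_sound : consistentb (P, F) -> consistent P F.
Proof.
move=> cons S C S' C' vS vC r.
suff H g g' : reach P g g' -> valid_cstate P g.1 -> valid_chans P g.2 ->
  inR F g.1 g.2 -> inR F g'.1 g'.2 by exact: (H _ _ r).
elim=> {S C S' C' vS vC r g g'} // -[S C] [S1 C1] g'' st _ IH /= vS vC inS.
have [vS1 vC1] := valid_step vS vC st; apply: IH => //=.
have [_ memF _ _] := wfF; have /mapP[e eF eS] := memF S vS.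
have /allP/(_ e eF)/implyP := consistentb_closed cons vC.
move: inS; rewrite /inR eS (fam_lookup_mem eF) => /in_recP ->.
move=> /(_ isT)/allP cl.
have [j [jn [p [s [xi [k [q [tT [Sj [eS1 [xiE stx]]]]]]]]]]] := st.
have /cl/allP/(_ _ tT)/implyP : j \in iota 0 (nnodes P) by rewrite mem_iota.
rewrite -eS /enabled /fire /t_src /t_send /t_edge /t_msg /t_dst /= Sj eqxx -eS1.
case: s tT stx => _ => [[_ ->]|[_ [rest [-> ->]]]] /=; first by move=> /(_ isT)/in_recP.
by rewrite eqxx => /(_ isT)/in_recP.
Qed.

(** Every case examined by the search is a computation of length one from a valid global state. *)
Lemma consistentb_complete : consistent P F -> consistentb (P, F).
Proof.
move=> cons; apply/allP => C; rewrite mem_strings => /andP[/eqP sC _].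
apply/implyP => /(valid_chansP sC) vC; apply/allP => e eF; apply/implyP => /in_recP inC.
apply/allP => j; rewrite mem_iota /= => jn; apply/allP => t tT; apply/implyP => en.
apply/in_recP; have [_ _ Fv _] := wfF; apply: (cons e.1 C) => //.
- by apply: Fv; apply: map_f.
- apply: reach_step (reach_refl _ _); exists j; split => //.
  (* [wf_transition] supplies the edge bound and the endpoint condition that [step] demands. *)
  have [_ _ /(_ j jn) [_ /allP /(_ _ tT)]] := wfP.
  case: t tT en => [[p [[s xi] k]] q] tT; rewrite /enabled /fire /t_src /t_send /t_edge /t_msg /t_dst /=.
  move=> /andP[/eqP Sj en] /and5P[_ _ xiE _ sj].
  exists p, s, xi, k, q; split => //; split => //; split => //; split => //.
  case: s en sj {tT} => /= [_ /eqP//|/eqP en /eqP hj]; split => //.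
  by exists (behead (nth [::] C xi)).
- by rewrite /inR fam_lookup_mem.
Qed.

End Correctness.

Theorem theorem9p4 :
  exists prog : program, forall x : instance, wf_instance x ->
    exists n : nat,
      let c := rm_run prog n (rm_init (pickle x)) in
      rm_halted prog c /\ (rm_output c = 1 <-> consistent x.1 x.2).
Proof.
have [g /while_computable_rm [prog progP] gE] := computable_consistentb.
exists prog => -[P F] [wfP wfF]; have [n] := progP (pickle (P, F)).
rewrite gE => /= -[halt out]; exists n; split => //; rewrite out.
(* Booleans are coded by 0 and 1, so output 1 means that the test succeeded. *)
have -> : pickle (consistentb (P, F)) = consistentb (P, F) by case: consistentb.
split=> [|/(consistentb_complete wfP wfF) -> //].
by case E: consistentb => // _; apply: consistentb_sound.
Qed.
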